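(* A countable linear order $\mathcal{A}$ is weakly ultrahomogeneous if and only if $\mathcal{A}$ has finitely many successivities.
   Context: In a linear order $(A,<)$, $b$ is the successor of $a$ (and $a$ the predecessor of $b$) if $a<b$ and there is no $x$ with $a<x<b$; then $(a,b)$ is a successor pair, and each of $a$ and $b$ is called a successivity. The order is regarded as a structure in the language $\{<\}$, so finitely generated substructures are finite suborders. $\mathcal{A}$ is weakly ultrahomogeneous if there is a finite set $\{a_1,\dots,a_n\}\subseteq A$ (an exceptional set) such that every isomorphism between finite substructures of $\mathcal{A}$ containing all $a_i$ and fixing each $a_i$ extends to an automorphism of $\mathcal{A}$. *)

(* Defs.v *)
From mathcomp Require Import all_boot all_order.
From mathcomp Require Import boolp classical_sets functions cardinality.

Set Implicit Arguments.
Unset Strict Implicit.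
Unset Printing Implicit Defensive.

Local Open Scope order_scope.
Local Open Scope classical_set_scope.

Section LinearOrder.
Context {d : Order.disp_t} {A : orderType d}.
Implicit Types (a b : A) (S T E : set A) (f g : A -> A).

Definition successor_pair a b : Prop :=
  a < b /\ ~ exists x : A, a < x < b.

Definition successivity a : Prop :=
  exists b : A, successor_pair a b \/ successor_pair b a.

(* The language {<} is relational, so every subset carries a substructure.
   An isomorphism from S onto T is represented by a function on all of A,
   whose values outside S are irrelevant. *)
Definition substructure_iso S T f : Prop :=
  set_bij S T f /\ {in S &, {mono f : x y / x < y}}.

Definition automorphism g : Prop :=
  bijective g /\ {mono g : x y / x < y}.

Definition exceptional_set E : Prop :=
  finite_set E /\
  forall S T f,
    finite_set S -> finite_set T -> E `<=` S -> E `<=` T ->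
    substructure_iso S T f ->
    (forall a, E a -> f a = a) ->
    exists g, automorphism g /\ (forall x, S x -> g x = f x).

End LinearOrder.

Definition weakly_ultrahomogeneous (d : Order.disp_t) (A : orderType d) : Prop :=
  exists E : set A, exceptional_set E.

(* Main.v *)
Require Import Defs.
From mathcomp Require Import all_boot all_order.
From mathcomp Require Import boolp classical_sets functions cardinality.

(** Why the theorem is true.

    Suppose that there are finitely many successivities, and let E consist of
    them together with the least and the greatest element, if these exist.  A
    finite partial isomorphism that fixes E pointwise can be extended to any
    further point x ([one_point_extension]): if l < x < u are the neighbours of
    x in its domain, the images of l and u cannot form a successor pair, for
    they would both lie in E, hence be fixed, so that l and u themselves would
    form the same successor pair and leave no room for x.  When l or u does not
    exist, the endpoints in E play the same role.  The hypothesis on the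
    partial isomorphism is symmetric, so the usual back-and-forth construction
    over a countable order ([back_and_forth]) extends it to an automorphism.

    Conversely, let E be exceptional.  Two points lie in the same cut of E when
    they compare in the same way with every point of E; an order isomorphism
    between two pairs of points of one cut can be realised by an automorphism
    ([exceptional_pair_transitive]).  An automorphism cannot carry a successor
    pair to a pair with a point strictly between.  Hence if x < y < z lie in one
    cut, x has no successor and z has no predecessor
    ([no_successor_left_of_triple], [no_predecessor_right_of_triple]).  The
    middle one of five points of one cut is therefore not a successivity, so
    every cut contains at most four of them, and a finite set has finitely many
    cuts. *)

Import Order.TTheory.

Local Open Scope order_scope.
Local Open Scope classical_set_scope.

(** * Finite partial isomorphisms and back-and-forth *)

(** A finite partial isomorphism, given by its graph.  Over total orders the
    single condition below forces the graph to be functional and injective, and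
    it is visibly symmetric in the two orders. *)
Definition partial_iso {d d' : Order.disp_t} {A : orderType d}
    {B : orderType d'} (r : seq (A * B)) : Prop :=
  {in r &, forall p q, (p.1 < q.1) = (p.2 < q.2)}.

Definition swap {A B : Type} (p : A * B) : B * A := (p.2, p.1).

Section PartialIso.
Context {d d' : Order.disp_t} {A : orderType d} {B : orderType d'}.
Implicit Types (r : seq (A * B)) (p q : A * B).

Lemma eq_of_lt_eq {e e' : Order.disp_t} {C : orderType e} {D : orderType e'}
    (x y : C) (u v : D) :
  (x < y) = (u < v) -> (y < x) = (v < u) -> x = y -> u = v.
Proof.
move=> xyuv yxvu exy; move: xyuv yxvu; rewrite exy ltxx.
by case: (ltgtP u v).
Qed.

Lemma partial_iso_fun {r p q} : partial_iso r -> p \in r -> q \in r ->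
  p.1 = q.1 -> p.2 = q.2.
Proof. by move=> isor pr qr; apply: eq_of_lt_eq; apply: isor. Qed.

Lemma partial_iso_inj {r p q} : partial_iso r -> p \in r -> q \in r ->
  p.2 = q.2 -> p.1 = q.1.
Proof. by move=> isor pr qr; apply: eq_of_lt_eq; rewrite isor. Qed.

Lemma partial_iso_swap {r} : partial_iso r -> partial_iso (map swap r).
Proof. by move=> isor _ _ /mapP[p pr ->] /mapP[q qr ->] /=; rewrite isor. Qed.

Lemma partial_iso_cons {r} {x : A} {y : B} : partial_iso r ->
    (forall p, p \in r -> (x < p.1) = (y < p.2)) ->
    (forall p, p \in r -> (p.1 < x) = (p.2 < y)) ->
  partial_iso ((x, y) :: r).
Proof.
move=> isor xr rx p q; rewrite !inE => /orP[/eqP->|pr] /orP[/eqP->|qr] /=.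
- by rewrite !ltxx.
- exact: xr.
- exact: rx.
- exact: isor.
Qed.

(** The n-th stage of the construction treats the points of code n in both
    orders; the union of the stages is the graph of the isomorphism. *)
Lemma back_and_forth (good : set (seq (A * B))) r0 :
    countable [set: A] -> countable [set: B] ->
    (forall r, good r -> partial_iso r) ->
    (forall r x, good r -> exists y, good ((x, y) :: r)) ->
    (forall r y, good r -> exists x, good ((x, y) :: r)) ->
    good r0 ->
  exists g : A -> B, [/\ bijective g, {mono g : x y / x < y}
    & forall p, p \in r0 -> g p.1 = p.2].
Proof.
move=> /countable_injP[cA cA_inj] /countable_injP[cB cB_inj] iso forth back gr0.
have grow r n : exists r', good r ->
    [/\ good r', {subset r <= r'},
        forall x, cA x = n -> exists y, (x, y) \in r'
      & forall y, cB y = n -> exists x, (x, y) \in r'].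
  have [gr|] := pselect (good r); last by move=> ?; exists r.
  have [r1 [gr1 rr1 hr1]] : exists r1, [/\ good r1, {subset r <= r1}
      & forall x, cA x = n -> exists y, (x, y) \in r1].
    have [[x xn]|nx] := pselect (exists x, cA x = n); last first.
      by exists r; split=> // x xn; case: nx; exists x.
    have [y gy] := forth r x gr; exists ((x, y) :: r); split=> //.
      by move=> p pr; rewrite inE pr orbT.
    move=> x' x'n; exists y.
    by rewrite (cA_inj x' x) ?in_setT ?x'n ?xn// mem_head.
  have [[y yn]|ny] := pselect (exists y, cB y = n); last first.
    by exists r1; split=> // y yn; case: ny; exists y.
  have [x gx] := back r1 y gr1; exists ((x, y) :: r1); split=> //.
  - by move=> p /rr1 pr; rewrite inE pr orbT.
  - by move=> x' /hr1[y' x'y']; exists y'; rewrite inE x'y' orbT.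
  - move=> y' y'n; exists x.
    by rewrite (cB_inj y' y) ?in_setT ?y'n ?yn// mem_head.
have [step stepP] := choice (fun rn => grow rn.1 rn.2).
pose R := fix R n := if n is m.+1 then step (R m, m) else r0.
have goodR n : good (R n).
  by elim: n => //= n /(stepP (R n, n))[].
have R_sub m n : (m <= n)%N -> {subset R m <= R n}.
  elim: n => [|n IHn]; first by rewrite leqn0 => /eqP->.
  rewrite leq_eqVlt => /orP[/eqP-> //|]; rewrite ltnS => /IHn mn p /mn pn.
  by have [_ sub _ _] := stepP (R n, n) (goodR n); apply: sub.
have join p q m n : p \in R m -> q \in R n ->
    exists2 k, p \in R k & q \in R k.
  by move=> pm qn; exists (maxn m n); [apply: R_sub pm|apply: R_sub qn];
    rewrite ?leq_maxl ?leq_maxr.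
have Rdom x : exists y, exists n, (x, y) \in R n.
  have [_ _ hx _] := stepP (R (cA x), cA x) (goodR (cA x)).
  by have [y xy] := hx x erefl; exists y; exists (cA x).+1.
have Rcod y : exists x, exists n, (x, y) \in R n.
  have [_ _ _ hy] := stepP (R (cB y), cB y) (goodR (cB y)).
  by have [x xy] := hy y erefl; exists x; exists (cB y).+1.
have [g gP] := choice Rdom; have [h hP] := choice Rcod.
exists g; split.
- exists h => [x|y].
  + have [m xm] := gP x; have [n yn] := hP (g x).
    have [k pk qk] := join _ _ _ _ xm yn.
    by have := partial_iso_inj (iso _ (goodR k)) qk pk; apply.
  + have [m ym] := hP y; have [n xn] := gP (h y).
    have [k pk qk] := join _ _ _ _ ym xn.
    by have := partial_iso_fun (iso _ (goodR k)) qk pk; apply.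
- move=> x y; have [m xm] := gP x; have [n yn] := gP y.
  have [k pk qk] := join _ _ _ _ xm yn.
  exact/esym/(iso _ (goodR k) _ _ pk qk).
- move=> p pr0; have [n xn] := gP p.1.
  have [k pk qk] := join p (p.1, g p.1) 0 n pr0 xn.
  by have := partial_iso_fun (iso _ (goodR k)) qk pk; apply.
Qed.

End PartialIso.

(** * Finitely many successivities imply weak ultrahomogeneity *)

Lemma greatest_or_none {d : Order.disp_t} {A : orderType d} {T : eqType}
    (key : T -> A) (P : pred T) (s : seq T) :
  (forall q, q \in s -> ~~ P q) \/
  exists p, [/\ p \in s, P p & forall q, q \in s -> P q -> key q <= key p].
Proof.
elim: s => [|a s IHs]; first by left.
have [Pa|nPa] := boolP (P a); last first.
  case: IHs => [none|[p [ps Pp pmax]]].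
    by left=> q; rewrite inE => /orP[/eqP->//|/none].
  right; exists p; split=> // [|q]; first by rewrite inE ps orbT.
  by rewrite inE => /orP[/eqP-> Pa|]; [rewrite Pa in nPa|exact: pmax].
right; case: IHs => [none|[p [ps Pp pmax]]].
  exists a; split=> // [|q]; first exact: mem_head.
  by rewrite inE => /orP[/eqP->//|/none/negP].
have [lepa|/ltW leap] := leP (key p) (key a).
  exists a; split=> // [|q]; first exact: mem_head.
  by rewrite inE => /orP[/eqP->//|qs Pq]; apply: le_trans lepa; apply: pmax.
exists p; split=> // [|q]; first by rewrite inE ps orbT.
by rewrite inE => /orP[/eqP->//|]; exact: pmax.
Qed.

Lemma least_or_none {d : Order.disp_t} {A : orderType d} {T : eqType}
    (key : T -> A) (P : pred T) (s : seq T) :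
  (forall q, q \in s -> ~~ P q) \/
  exists p, [/\ p \in s, P p & forall q, q \in s -> P q -> key p <= key q].
Proof.
case: (greatest_or_none (A := A^d) key P s) => [|[p [ps Pp pmax]]]; first by left.
by right; exists p; split=> // q qs Pq; rewrite -leEdual; exact: pmax.
Qed.

Section Extension.
Context {d : Order.disp_t} {A : orderType d}.
Implicit Types (E : set A) (r : seq (A * A)) (a b x y : A).

Definition endpoint a : Prop := (forall x, a <= x) \/ (forall x, x <= a).

Definition fixes E r : Prop := forall a, E a -> (a, a) \in r.

Lemma finite_endpoints : finite_set [set a : A | endpoint a].
Proof.
have fin1 (S : set A) : (forall a b, S a -> S b -> a = b) -> finite_set S.
  move=> S1; have [->|/set0P[a Sa]] := eqVneq S set0; first exact: finite_set0.
  by apply: (sub_finite_set _ (finite_set1 a)) => b Sb /=; exact: S1.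
rewrite (_ : [set _ | _] =
  [set a | forall x, a <= x] `|` [set a | forall x, x <= a]) //.
by rewrite finite_setU; split; apply: fin1 => a b /= ha hb;
  apply/le_anti; rewrite ha hb.
Qed.

Lemma between_or_successor_pair a b : a < b ->
  (exists x, a < x < b) \/ successor_pair a b.
Proof. by move=> ab; case: (pselect (exists x, a < x < b)); [left|right]. Qed.

Lemma fixed_of_image {E r p} : partial_iso r -> fixes E r -> p \in r ->
  E p.2 -> p.1 = p.2.
Proof.
by move=> isor fixr pr /fixr; move=> p2; apply: (partial_iso_inj isor pr p2).
Qed.

(** Only the images of the two neighbours of x matter: if they leave no room
    for an image of x, they are in E, so they are fixed, and then the
    neighbours leave no room for x either. *)
Lemma one_point_extension {E r} x :
    (forall a, successivity a -> E a) -> (forall a, endpoint a -> E a) ->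
    partial_iso r -> fixes E r ->
  exists y, partial_iso ((x, y) :: r).
Proof.
move=> succE endE isor fixr.
have [[p pr px]|xr] := pselect (exists2 p, p \in r & p.1 = x).
  exists p.2; rewrite -px; apply: partial_iso_cons => // q qr; exact: isor.
suff [y [ly uy]] : exists y, (forall p, p \in r -> p.1 < x -> p.2 < y) /\
    (forall p, p \in r -> x < p.1 -> y < p.2).
  exists y; apply: partial_iso_cons => // p pr.
    by case: (ltgtP x p.1) => [/uy->//|/ly/lt_gtF->//|e]; case: xr; exists p.
  by case: (ltgtP x p.1) => [/uy/lt_gtF->//|/ly->//|e]; case: xr; exists p.
have fixed p : p \in r -> E p.2 -> p.1 = p.2 := fixed_of_image isor fixr.
have no_lt_end p : p \in r -> x < p.1 -> exists y, y < p.2.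
  move=> pr xp; apply: contrapT => nlt.
  have p2min z : p.2 <= z by rewrite leNgt; apply/negP => ?; apply: nlt; exists z.
  move: xp; rewrite (fixed p pr (endE _ (or_introl p2min))).
  by rewrite ltNge p2min.
have no_gt_end p : p \in r -> p.1 < x -> exists y, p.2 < y.
  move=> pr px; apply: contrapT => ngt.
  have p2max z : z <= p.2 by rewrite leNgt; apply/negP => ?; apply: ngt; exists z.
  move: px; rewrite (fixed p pr (endE _ (or_intror p2max))).
  by rewrite ltNge p2max.
have [noL|[l [lr lx lmax]]] := greatest_or_none snd (fun p => p.1 < x) r;
have [noU|[u [ur xu umin]]] := least_or_none snd (fun p => x < p.1) r.
- by exists x; split=> p pr; [move/negP: (noL p pr)|move/negP: (noU p pr)].
- have [y yu] := no_lt_end u ur xu.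
  exists y; split=> p pr; first by move/negP: (noL p pr).
  by move=> /(umin p pr); exact: lt_le_trans.
- have [y ly] := no_gt_end l lr lx.
  exists y; split=> p pr; last by move/negP: (noU p pr).
  by move=> /(lmax p pr) /le_lt_trans; apply.
- have lu : l.2 < u.2 by rewrite -(isor l u lr ur) (lt_trans lx).
  have [[y /andP[ly yu]]|adj] := between_or_successor_pair _ _ lu.
    exists y; split=> p pr; first by move=> /(lmax p pr) /le_lt_trans; apply.
    by move=> /(umin p pr); exact: lt_le_trans.
  have El : E l.2 by apply: succE; exists u.2; left.
  have Eu : E u.2 by apply: succE; exists l.2; right.
  case: (adj) => _ []; exists x.
  by rewrite -(fixed l lr El) -(fixed u ur Eu) lx.
Qed.

Lemma partial_iso_extends {E r} : countable [set: A] ->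
    (forall a, successivity a -> E a) -> (forall a, endpoint a -> E a) ->
    partial_iso r -> fixes E r ->
  exists g : A -> A, automorphism g /\ (forall p, p \in r -> g p.1 = p.2).
Proof.
move=> cA succE endE isor fixr.
have [||||g [gbij gmono gr]] :=
    back_and_forth (fun s => partial_iso s /\ fixes E s) r cA cA.
- by move=> s [].
- move=> s x [isos fixs].
  have [y isoy] := one_point_extension x succE endE isos fixs.
  by exists y; split=> // a /fixs; rewrite inE orbC => ->.
(* The back step is the forth step for the inverse partial isomorphism. *)
- move=> s y [isos fixs].
  have fixs' : fixes E (map swap s).
    by move=> a /fixs aas; apply/mapP; exists (a, a).
  have [x isox] := one_point_extension y succE endE (partial_iso_swap isos) fixs'.
  exists x; split=> [|a /fixs]; last by rewrite inE orbC => ->.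
  have := partial_iso_swap isox; rewrite /= -map_comp.
  by rewrite (_ : map _ s = s) // -[RHS]map_id; apply: eq_map => -[].
- by [].
- by exists g.
Qed.

Lemma exceptional_of_finite_successivities : countable [set: A] ->
    finite_set [set a : A | successivity a] ->
  exceptional_set [set a : A | successivity a \/ endpoint a].
Proof.
move=> cA fin_succ; split.
  rewrite (_ : [set _ | _] = [set a | successivity a] `|` [set a | endpoint a]) //.
  by rewrite finite_setU; split=> //; exact: finite_endpoints.
move=> S T f /finite_seqP[s sE] _ ES _ [_ fmono] fE.
have mem_s a : (a \in s) = (a \in S).
  by rewrite sE; apply/idP/idP; rewrite in_setE.
pose r := [seq (a, f a) | a <- s].
have isor : partial_iso r.
  move=> _ _ /mapP[a sa ->] /mapP[b sb ->] /=.
  by rewrite fmono // -mem_s.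
have fixr : fixes [set a | successivity a \/ endpoint a] r.
  move=> a Ea; apply/mapP; exists a; last by rewrite fE.
  by rewrite mem_s in_setE; exact: ES.
have [g [autg gr]] := partial_iso_extends cA
  (fun a => @or_introl _ _) (fun a => @or_intror _ _) isor fixr.
exists g; split=> // x Sx.
have xr : (x, f x) \in r by apply/mapP; exists x; rewrite // mem_s in_setE.
exact: (gr _ xr).
Qed.

End Extension.

(** * Weak ultrahomogeneity implies finitely many successivities *)

Lemma finite_of_finite_fibers {T : Type} {K : finType} (k : T -> K)
    (S : set T) :
  (forall i, finite_set [set a | S a /\ k a = i]) -> finite_set S.
Proof.
move=> fib.
apply: (@sub_finite_set _ _ (\bigcup_(i in [set: K]) [set a | S a /\ k a = i])).
  by move=> a Sa; exists (k a).
by apply: bigcup_finite => //; exact: finite_finset.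
Qed.

Section Cuts.
Context {d : Order.disp_t} {A : orderType d}.
Implicit Types (E : set A) (a b c x y z : A).

(** Comparing strictly on both sides makes every point of E alone in its cut,
    so that a cut with two points is disjoint from E. *)
Definition same_cut E x y : Prop :=
  forall e, E e -> (e < x) = (e < y) /\ (x < e) = (y < e).

Lemma same_cut_convex {E c x y z} : same_cut E x c -> same_cut E z c ->
  x <= y -> y <= z -> same_cut E y c.
Proof.
move=> xc zc xy yz e Ee; have [ex xe] := xc e Ee; have [ez ze] := zc e Ee.
split; apply/idP/idP.
- by rewrite -ez => /lt_le_trans; apply.
- by rewrite -ex => /lt_le_trans; apply.
- by rewrite -xe; exact: le_lt_trans.
- by rewrite -ze; exact: le_lt_trans.
Qed.

Lemma same_cut_notin {E c x y} : same_cut E x c -> same_cut E y c -> x < y ->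
  ~ E x /\ ~ E y.
Proof.
move=> xc yc xy; split=> [Ex|Ey].
  by have [+ _] := xc x Ex; have [<- _] := yc x Ex; rewrite xy ltxx.
by have [_ +] := yc y Ey; have [_ <-] := xc y Ey; rewrite xy ltxx.
Qed.

(** Points of one cut see E alike, so moving u1, u2 to v1, v2 while fixing E is
    a finite isomorphism; it is well defined because u1 < u2 in a common cut
    rules out that either belongs to E. *)
Lemma exceptional_pair_transitive {E c u1 u2 v1 v2} : exceptional_set E ->
    same_cut E u1 c -> same_cut E u2 c -> same_cut E v1 c -> same_cut E v2 c ->
    u1 < u2 -> v1 < v2 ->
  exists g : A -> A, [/\ automorphism g, g u1 = v1 & g u2 = v2].
Proof.
move=> [finE excE] u1c u2c v1c v2c u12 v12.
have [nEu1 nEu2] := same_cut_notin u1c u2c u12.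
pose f a := if a == u1 then v1 else if a == u2 then v2 else a.
have f1 : f u1 = v1 by rewrite /f eqxx.
have f2 : f u2 = v2 by rewrite /f eqxx (gt_eqF u12).
have fE a : E a -> f a = a.
  by rewrite /f; case: eqP => [->//|_]; case: eqP => [->//|_].
pose with2 (x y : A) := E `|` [set x; y].
have fin2 x y : finite_set (with2 x y).
  by rewrite /with2 !finite_setU; split=> //; split; exact: finite_set1.
have fmono : {in with2 u1 u2 &, {mono f : x y / x < y}}.
  move=> x y; rewrite !in_setE => -[Ex|[->|->]] [Ey|[->|->]];
    rewrite ?f1 ?f2 ?fE ?ltxx ?u12 ?v12 ?(lt_gtF u12) ?(lt_gtF v12) //.
  - by rewrite (u1c x Ex).1 (v1c x Ex).1.
  - by rewrite (u2c x Ex).1 (v2c x Ex).1.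
  - by rewrite (u1c y Ey).2 (v1c y Ey).2.
  - by rewrite (u2c y Ey).2 (v2c y Ey).2.
have [||||g [autg gf]] := excE _ _ f (fin2 u1 u2) (fin2 v1 v2).
- by move=> x; left.
- by move=> x; left.
- split=> //; split.
  + move=> x [Ex|[->|->]]; [left|right; left|right; right] => //=.
    by rewrite fE.
  + move=> x y xS yS; apply: eq_of_lt_eq; apply: fmono => //.
  + move=> y [Ey|[->|->]].
    * by exists y; [left|exact: fE].
    * by exists u1 => //; right; left.
    * by exists u2 => //; right; right.
- exact: fE.
- exists g; split=> //; rewrite gf //.
    by right; left.
  by right; right.
Qed.

Lemma automorphism_successor_pair {g : A -> A} {a b} : automorphism g ->
  successor_pair a b -> successor_pair (g a) (g b).
Proof.
move=> [[h gK hK] gmono] [ab nab]; split; first by rewrite gmono.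
move=> [x]; rewrite -(hK x) !gmono => axb.
by apply: nab; exists (h x).
Qed.

Lemma exceptional_cut_homogeneous {E c a b x y z} : exceptional_set E ->
    same_cut E a c -> same_cut E b c -> same_cut E x c -> same_cut E z c ->
    successor_pair a b -> x < y -> y < z ->
  False.
Proof.
move=> excE ac bc xc zc adj xy yz.
have [g [autg ga gb]] := exceptional_pair_transitive excE ac bc xc zc
  (proj1 adj) (lt_trans xy yz).
have [_] := automorphism_successor_pair autg adj; rewrite ga gb; apply.
by exists y; rewrite xy.
Qed.

(** The successor of x would be at most y, hence in the same cut. *)
Lemma no_successor_left_of_triple {E c x y z b} : exceptional_set E ->
    same_cut E x c -> same_cut E z c -> x < y -> y < z ->
  ~ successor_pair x b.
Proof.
move=> excE xc zc xy yz adj; have [xb nxb] := adj.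
have le_by : b <= y by rewrite leNgt; apply/negP => yb; apply: nxb; exists y; rewrite xy.
have bc := same_cut_convex xc zc (ltW xb) (le_trans le_by (ltW yz)).
exact: (exceptional_cut_homogeneous excE xc bc xc zc adj xy yz).
Qed.

Lemma no_predecessor_right_of_triple {E c x y z b} : exceptional_set E ->
    same_cut E x c -> same_cut E z c -> x < y -> y < z ->
  ~ successor_pair b z.
Proof.
move=> excE xc zc xy yz adj; have [bz nbz] := adj.
have yb : y <= b by rewrite leNgt; apply/negP => yb; apply: nbz; exists y; rewrite yb.
have bc := same_cut_convex xc zc (le_trans (ltW xy) yb) (ltW bz).
exact: (exceptional_cut_homogeneous excE bc zc xc zc adj xy yz).
Qed.

(** Five points give a third one with two points of the cut on either side, so
    that it has neither a successor nor a predecessor. *)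
Lemma finite_successivities_cut {E} c : exceptional_set E ->
  finite_set [set a : A | successivity a /\ same_cut E a c].
Proof.
move=> excE; apply: contrapT => /(infinite_set_fset 5)[B Bsub szB].
have : sorted <%O (sort <=%O (finmap.enum_fset B)).
  by rewrite sort_lt_sorted; exact: finmap.fset_uniq.
have : (4 < size (sort <=%O (finmap.enum_fset B)))%N by rewrite size_sort.
have : {in sort <=%O (finmap.enum_fset B), forall a,
    successivity a /\ same_cut E a c}.
  by move=> a; rewrite mem_sort => aB; exact: Bsub.
case: sort => [|a1 [|a2 [|a3 [|a4 [|a5 s]]]]] //= sB _.
case/and5P=> a12 a23 a34 a45 _.
have ac a : a \in [:: a1, a2, a3, a4, a5 & s] -> same_cut E a c.
  by case/sB.
have c1 : same_cut E a1 c by apply: ac; rewrite !inE eqxx ?orbT.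
have c3 : same_cut E a3 c by apply: ac; rewrite !inE eqxx ?orbT.
have c5 : same_cut E a5 c by apply: ac; rewrite !inE eqxx ?orbT.
have [|[b [a3b|ba3]] _] := sB a3; first by rewrite !inE eqxx ?orbT.
- exact: (no_successor_left_of_triple excE c3 c5 a34 a45 a3b).
- exact: (no_predecessor_right_of_triple excE c1 c3 a12 a23 ba3).
Qed.

Lemma finite_successivities_of_exceptional {E} : exceptional_set E ->
  finite_set [set a : A | successivity a].
Proof.
move=> excE; have /finite_seqP[s sE] := excE.1.
(* The cut of a, recorded as one pair of booleans for each point of E. *)
pose side a := [tuple of [seq (e < a, a < e) | e <- in_tuple s]].
apply: (finite_of_finite_fibers side) => k.
have [[c ck]|nk] := pselect (exists c, side c = k); last first.
  by apply: (sub_finite_set _ (@finite_set0 A)) => a [_ ak]; apply: nk; exists a.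
apply: (sub_finite_set _ (finite_successivities_cut c excE)) => a [sa ak].
split=> // e; rewrite sE /= => es.
have /(congr1 val)/eq_in_map/(_ e es)[-> ->] : side a = side c by rewrite ak ck.
by [].
Qed.

End Cuts.

Theorem theorem3p2 (d : Order.disp_t) (A : orderType d)
    (A_countable : countable [set: A]) :
  weakly_ultrahomogeneous A <-> finite_set [set a : A | successivity a].
Proof.
split=> [[E excE]|fin_succ].
  exact: finite_successivities_of_exceptional excE.
eexists; exact: exceptional_of_finite_successivities A_countable fin_succ.
Qed.
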